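(* Let $\underline u\in C^\infty(X)$. Suppose that $(F,\mathcal A)$ is det-elliptic with constants $\eta,\beta>0$ and that $\omega_{\underline u}-\chi\in\mathcal A$ at every point of $X$, where $\omega_{\underline u}=\omega+dd^c\underline u$ and $\omega,\chi$ are smooth closed real $(1,1)$-forms; let $\psi\in C^\infty(X)$, $\psi>0$. Then for every $x\in X$, every $P\in\mathcal Q_x^+$ satisfying $$\omega_{\underline u}(x)-\chi(x)+P\in\mathcal A_x,\qquad F_x(\omega_{\underline u}(x)-\chi(x)+P)\le\psi(x)$$ obeys $$\det_\rho P\le d(x),\qquad d(x):=\Bigl[\eta^{-1}\bigl(\psi(x)-F_x(\omega_{\underline u}(x)-\chi(x))\bigr)_+\Bigr]^{1/\beta}.$$ Consequently, $(\omega_{\underline u},\chi,\gamma)$ is a $\mathcal D$-subsolution for every continuous $\gamma:X\to\mathbb R$ with $e^\gamma\ge d$.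
   Context: $(X,\rho)$ is a connected compact Kähler manifold of complex dimension $n$; $dd^c$ is the usual real operator (a fixed positive multiple of $i\partial\bar\partial$). $\mathcal Q$ is the bundle of real $(1,1)$-forms with fibers $\mathcal Q_x$; $\mathcal Q_x^+$, $\mathcal Q_x^{++}$ are the semipositive and positive definite forms; $\det_\rho$ is the product of $\rho$-eigenvalues. Admissible pair: $\mathcal A\subset\mathcal Q$ is open, $F\in C^\infty(\mathcal A,\mathbb R)$, and for every $x\in X$, with $\mathcal A_x=\mathcal A\cap\mathcal Q_x$: (A1) $\mathcal A_x\ne\varnothing$ and $\mathcal A_x+\mathcal Q_x^+\subset\mathcal A_x$; (A2) $F_x(A+P)>F_x(A)$ for $A\in\mathcal A_x$, $P\in\mathcal Q_x^{++}$; (A3) for every $A_0\in\partial\mathcal A_x$, $\limsup_{A\in\mathcal A_x,\,A\to A_0}F_x(A)\le0$. Det-elliptic: an admissible pair $(F,\mathcal A)$ is det-elliptic with constants $\eta,\beta>0$ if $F_x(A+P)-F_x(A)\ge\eta\det_\rho(P)^\beta$ for every $x\in X$, $A\in\mathcal A_x$, $P\in\mathcal Q_x^{++}$. $\mathcal D$-subsolution (of $F_x(\omega+dd^cu)=\psi$): $(\omega_{\underline u},\chi,\gamma)$ with $\gamma\in C(X,\mathbb R)$ is a $\mathcal D$-subsolution if for every $x\in X$ and $P\in\mathcal Q_x^+$ with $\omega_{\underline u}(x)-\chi(x)+P\in\mathcal A_x$ and $F_x(\omega_{\underline u}(x)-\chi(x)+P)\le\psi(x)$, one has $\det_{\rho(x)}P\le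 e^{\gamma(x)}$. *)

(* Defs.v *)
From HB Require Import structures.
From mathcomp Require Import all_boot all_order all_algebra.
From mathcomp Require Import all_classical all_reals all_analysis.
From mathcomp Require Import complex.

Set Implicit Arguments.
Unset Strict Implicit.
Unset Printing Implicit Defensive.

Import Order.TTheory GRing.Theory Num.Theory.
Import numFieldNormedType.Exports.

Local Open Scope classical_set_scope.
Local Open Scope complex_scope.
Local Open Scope ring_scope.

(* C^n as a real normed space: the pair (x, y) is the point x + i y. *)
Notation "'Cspace[' R ]_ n" := ('rV[R]_n * 'rV[R]_n)%type
  (at level 8, n at level 2, format "'Cspace[' R ]_ n").

Section Calculus.
Variable R : realType.

(* C^oo on an open subset U of a finite-dimensional space: all iterated
   directional derivatives exist and are continuous on U. *)
Definition smooth_on (V : normedModType R) (U : set V) (f : V -> R) : Prop :=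
  forall vs : seq V, let g := foldr (fun v h => 'D_v h) f vs in
  forall p, U p -> {for p, continuous g} /\ forall v, derivable g p v.

Definition csmooth_on (V : normedModType R) (U : set V) (f : V -> R[i]) : Prop :=
  smooth_on U (fun p => complex.Re (f p)) /\
  smooth_on U (fun p => complex.Im (f p)).

Definition cderive (V : normedModType R) (v : V) (f : V -> R[i]) (p : V) : R[i] :=
  'D_v (fun q => complex.Re (f q)) p +i* 'D_v (fun q => complex.Im (f q)) p.

Variable n : nat.
Local Notation V := Cspace[R]_n.

Definition zcoord (p : V) (k : 'I_n) : R[i] := p.1 ord0 k +i* p.2 ord0 k.

(* Wirtinger derivatives d/dz_k and d/dzbar_k. *)
Definition dz (k : 'I_n) (f : V -> R[i]) (p : V) : R[i] :=
  (cderive (delta_mx ord0 k, 0) f p - 'i%C * cderive (0, delta_mx ord0 k) f p) / 2.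
Definition dzbar (k : 'I_n) (f : V -> R[i]) (p : V) : R[i] :=
  (cderive (delta_mx ord0 k, 0) f p + 'i%C * cderive (0, delta_mx ord0 k) f p) / 2.

Definition holomorphic_on (U : set V) (f : V -> R[i]) : Prop :=
  csmooth_on U f /\ forall k p, U p -> dzbar k f p = 0.

End Calculus.

Record complexManifold (R : realType) (n : nat) := ComplexManifold {
  point_of :> topologicalType;
  chart_index : Type;
  dom : chart_index -> set point_of;
  chart : chart_index -> point_of -> Cspace[R]_n;
  chart_inv : chart_index -> Cspace[R]_n -> point_of;
  chart_at : point_of -> chart_index;
  _ : hausdorff_space point_of;
  _ : @second_countable point_of;
  _ : forall x, dom (chart_at x) x;
  _ : forall i, open (dom i);
  _ : forall i, open (chart i @` dom i);
  _ : forall i x, dom i x -> chart_inv i (chart i x) = x;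
  _ : forall i, {within dom i, continuous (chart i)};
  _ : forall i, {within chart i @` dom i, continuous (chart_inv i)};
  _ : forall i j k, holomorphic_on (chart i @` (dom i `&` dom j))
        (fun p => zcoord (chart j (chart_inv i p)) k)
}.

Section Forms.
Variables (R : realType) (n : nat) (X : complexManifold R n).
Local Notation V := Cspace[R]_n.

(* A (1,1)-form at a point is given by the family of its coefficient matrices
   in the charts of the atlas; in a chart, the matrix H stands for
   sqrt(-1) * \sum_(j, k) H j k dz_j /\ dzbar_k. *)
Local Notation coefs := (chart_index X -> 'M[R[i]]_n).

Definition cimage (i : chart_index X) : set V := chart i @` dom i.

Definition smooth_fun (f : X -> R) : Prop :=
  forall i, smooth_on (cimage i) (fun p => f (chart_inv i p)).

(* Complex Jacobian matrix, at p, of the change of charts from j to i. *)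
Definition jacobian (i j : chart_index X) (p : V) : 'M[R[i]]_n :=
  \matrix_(c, a) dz a (fun q => zcoord (chart i (chart_inv j q)) c) p.

(* The form at x whose matrix in the chart i is H; the matrices in the charts
   that do not contain x are normalized to 0. *)
Definition form_at (i : chart_index X) (x : X) (H : 'M[R[i]]_n) : coefs :=
  fun j => if x \in dom j then
             let D := jacobian i j (chart j x) in
             D^T *m H *m map_mx Num.conj D
           else 0.

(* The fibre Q_x of real (1,1)-forms at x. *)
Definition Q (x : X) : set coefs :=
  [set a | forall i, dom i x -> a i \is hermsymmx /\ a = form_at i x (a i)].

Definition hform (H : 'M[R[i]]_n) (v : 'rV[R[i]]_n) : R[i] :=
  (v *m H *m (map_mx Num.conj v)^T) ord0 ord0.

Definition Qpos (x : X) : set coefs :=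
  [set a | Q x a /\ forall i, dom i x -> forall v, 0 <= hform (a i) v].

Definition Qposdef (x : X) : set coefs :=
  [set a | Q x a /\
    forall i, dom i x -> forall v, v != 0 -> 0 < hform (a i) v].

Definition smooth_form (w : X -> coefs) : Prop :=
  (forall x, Q x (w x)) /\
  forall i j k, csmooth_on (cimage i) (fun p => w (chart_inv i p) i j k).

(* The components of dw on dz_l /\ dz_j /\ dzbar_k and on
   dzbar_l /\ dz_j /\ dzbar_k vanish. *)
Definition closed_form (w : X -> coefs) : Prop :=
  forall i p, cimage i p -> forall l j k,
    let c j k := fun q => w (chart_inv i q) i j k in
    dz l (c j k) p = dz j (c l k) p /\ dzbar l (c j k) p = dzbar k (c j l) p.

Definition kahler_form (rho : X -> coefs) : Prop :=
  smooth_form rho /\ closed_form rho /\ forall x, Qposdef x (rho x).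

(* kappa * sqrt(-1) * d dbar u, for a fixed normalization kappa > 0 of dd^c. *)
Definition ddc (kappa : R) (u : X -> R) (x : X) : coefs :=
  fun i => if x \in dom i then
             kappa%:C *: \matrix_(j, k)
               dz j (dzbar k (fun p => (u (chart_inv i p))%:C)) (chart i x)
           else 0.

(* Eigenvalues of H with respect to G, with multiplicity. *)
Definition rel_eigenvalues (G H : 'M[R[i]]_n) : seq R[i] :=
  sval (closed_field_poly_normal (char_poly (H *m invmx G))).

(* Product of the eigenvalues (which are real) of a with respect to rho x; the
   matrices in any other chart around x are congruent by a common Jacobian. *)
Definition det_rel (rho : X -> coefs) (x : X) (a : coefs) : R :=
  \prod_(l <- rel_eigenvalues (rho x (chart_at x)) (a (chart_at x)))
    complex.Re l.

(* The real-linear isomorphism from M_n(R) onto the Hermitian matrices with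
   inverse H |-> Re H + Im H.  It provides linear coordinates on the fibres,
   hence, with the charts of X, local trivializations of Q over open subsets of
   Cspace[R]_n * M_n(R). *)
Definition herm (M : 'M[R]_n) : 'M[R[i]]_n :=
  \matrix_(j, k) (((M j k + M k j) / 2) +i* ((M j k - M k j) / 2)).

Definition triv (i : chart_index X) (x : X) (M : 'M[R]_n) : coefs :=
  form_at i x (herm M).

Definition bundle_image (A : X -> set coefs) (i : chart_index X) :
    set (V * 'M[R]_n) :=
  [set p | cimage i p.1 /\
           A (chart_inv i p.1) (triv i (chart_inv i p.1) p.2)].

Definition fibre_image (A : X -> set coefs) (i : chart_index X) (x : X) :
    set 'M[R]_n :=
  [set M | A x (triv i x M)].

(* The subset A of the total space of Q is given by its fibres A_x; only the
   values of F x on A x matter.  In adm_boundary, the fibre carries the topology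
   of its coordinate space M_n(R). *)
Record admissible (F : X -> coefs -> R) (A : X -> set coefs) : Prop :=
  Admissible {
  adm_sub : forall x, A x `<=` Q x;
  adm_open : forall i, open (bundle_image A i);
  adm_smooth : forall i, smooth_on (bundle_image A i)
    (fun p => F (chart_inv i p.1) (triv i (chart_inv i p.1) p.2));
  adm_nonempty : forall x, A x !=set0;
  adm_cone : forall x a p, A x a -> Qpos x p -> A x (a + p);
  adm_increasing : forall x a p, A x a -> Qposdef x p -> F x a < F x (a + p);
  adm_boundary : forall x i M0, dom i x ->
    (closure (fibre_image A i x) `\` interior (fibre_image A i x)) M0 ->
    (limf_esup (fun M => (F x (triv i x M))%:E)
       (within (fibre_image A i x) (nbhs M0)) <= 0)%E
}.

Definition det_elliptic (rho : X -> coefs) (F : X -> coefs -> R)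
    (A : X -> set coefs) (eta beta : R) : Prop :=
  forall x a p, A x a -> Qposdef x p ->
    eta * det_rel rho x p `^ beta <= F x (a + p) - F x a.

Definition D_subsolution (rho : X -> coefs) (F : X -> coefs -> R)
    (A : X -> set coefs) (psi : X -> R) (w chi : X -> coefs) (gamma : X -> R) :
    Prop :=
  continuous gamma /\
  forall x p, Qpos x p -> A x (w x - chi x + p) ->
    F x (w x - chi x + p) <= psi x -> det_rel rho x p <= expR (gamma x).

End Forms.

(* Main.v *)
Require Import Defs.
From HB Require Import structures.
From mathcomp Require Import all_boot all_order all_algebra.
From mathcomp Require Import all_classical all_reals all_analysis.
From mathcomp Require Import complex ring.

Import Order.TTheory GRing.Theory Num.Theory.
Import numFieldNormedType.Exports.

Local Open Scope classical_set_scope.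
Local Open Scope ring_scope.

(** Det-ellipticity is exactly the asserted bound when [P] is positive definite:
    with [a] the value of [omega_u - chi] at [x], it gives
    [eta * (det P)^beta <= F_x(a + P) - F_x(a) <= psi(x) - F_x(a)], and taking
    the power [1/beta] yields [det P <= d(x)].  A semipositive [P] that is not
    positive definite is degenerate, so that [det P = 0 <= d(x)].

    The work lies in this dichotomy ([Qpos_det_rel_neq0]).  The relative
    determinant is the product of the roots of the characteristic polynomial of
    [H G^-1], read in one fixed chart, whereas positive definiteness is a
    condition in all charts around [x].  If the product is nonzero then [det H]
    is nonzero ([prod_rel_eigenvalues_det0]); the matrices in two charts are
    congruent, so invertibility passes to every chart ([Q_det_eq0]); and an
    invertible semipositive Hermitian matrix is positive definite
    ([semipositive_invertible_gt0]). *)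

Lemma row_mul_conj_gt0 (C : numClosedFieldType) (n : nat) (w : 'rV[C]_n) :
  w != 0 -> 0 < (w *m (map_mx Num.conj w)^T) ord0 ord0.
Proof.
have term_ge0 k : 0 <= w ord0 k * (map_mx Num.conj w)^T k ord0.
  by rewrite !mxE mul_conjC_ge0.
move=> w_neq0; rewrite lt_def mxE sumr_ge0 // andbT.
apply: contraNneq w_neq0 => /eqP; rewrite psumr_eq0 // => /allP w0.
apply/eqP/rowP=> k; have := w0 k (mem_index_enum _).
by rewrite !mxE mul_conjC_eq0 => /eqP.
Qed.

(** An isotropic vector [v] of a semipositive Hermitian form lies in its kernel:
    otherwise [w = v H] is nonzero, and along the real line [w - s v] the form
    is affine in [s] with slope [-2 |w|^2 < 0], hence takes negative values. *)
Lemma semipositive_invertible_gt0 (R : realType) (n : nat) (H : 'M[R[i]]_n) :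
  H \is hermsymmx -> (forall v, 0 <= hform H v) -> \det H != 0 ->
  forall v, v != 0 -> 0 < hform H v.
Proof.
move=> /is_hermitianmxP; rewrite expr0 scale1r => H_herm H_ge0 H_inv v v_neq0.
rewrite lt_def H_ge0 andbT; apply/negP => /eqP q_v0.
pose w := v *m H; pose z := (w *m (map_mx Num.conj w)^T) ord0 ord0.
have w_neq0 : w != 0.
  apply: contraNneq v_neq0 => w0; apply/eqP; rewrite -[v]mulmx1.
  have H_unit : H \in unitmx by rewrite unitmxE unitfE.
  by rewrite -(mulmxV H_unit) mulmxA -/w w0 mul0mx.
have z_gt0 : 0 < z by apply: row_mul_conj_gt0.
have H_adj : H *m (map_mx Num.conj v)^T = (map_mx Num.conj w)^T.
  rewrite {1}H_herm /w map_mxM trmx_mul; congr (_ *m _).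
  by rewrite map_trmx.
have q_along s : s \is Num.real ->
    hform H (w - s *: v) = hform H w - 2 * s * z.
  move=> /CrealP s_real.
  have -> : hform H (w - s *: v) =
      hform H w - s * z - s * z + s * s * hform H v.
    rewrite /hform.
    have -> : (map_mx Num.conj (w - s *: v))^T =
        (map_mx Num.conj w)^T - s *: (map_mx Num.conj v)^T.
      by apply/colP=> k; rewrite !mxE rmorphB rmorphM /= s_real.
    rewrite !mulmxBl !mulmxBr -!scalemxAl -!scalemxAr.
    rewrite -(mulmxA w H ((map_mx Num.conj v)^T)) H_adj -/w !mxE /z !mxE.
    ring.
  by rewrite q_v0; ring.
(* The parameter at which the affine function equals -1. *)
pose s := (hform H w + 1) / (2 * z).
have s_real : s \is Num.real.
  by rewrite ger0_real // divr_ge0 ?addr_ge0 ?mulr_ge0 // ltW.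
have := H_ge0 (w - s *: v); rewrite q_along //.
have -> : hform H w - 2 * s * z = - 1.
  by rewrite /s; field; rewrite gt_eqF.
by rewrite oppr_ge0 ler10.
Qed.

(** A singular [H] makes [0] a root of the characteristic polynomial of
    [H G^-1], hence one of the factors. *)
Lemma prod_rel_eigenvalues_det0 (R : realType) (n : nat) (G H : 'M[R[i]]_n) :
  \det H = 0 -> \prod_(l <- rel_eigenvalues G H) complex.Re l = 0.
Proof.
move=> det0; rewrite /rel_eigenvalues.
case: closed_field_poly_normal => r /= rE.
have : root (char_poly (H *m invmx G)) 0.
  by rewrite /root horner_coef0 char_poly_det det_mulmx det0 mul0r mulr0.
rewrite rE (monicP (char_poly_monic _)) scale1r root_prod_XsubC => r0.
by apply/eqP; rewrite prodf_seq_eq0; apply/hasP; exists 0; rewrite ?eqxx.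
Qed.

(** By the transformation rule [a j = D^T (a i) conj D], with [D] the Jacobian
    of the change of charts, [det (a i)] is a factor of [det (a j)]. *)
Lemma Q_det_eq0 (R : realType) (n : nat) (X : complexManifold R n) (x : X)
    (a : chart_index X -> 'M[R[i]]_n) (i j : chart_index X) :
  Q x a -> dom i x -> dom j x -> \det (a i) = 0 -> \det (a j) = 0.
Proof.
move=> Qa xi xj det0; have [_ ->] := Qa i xi.
by rewrite /form_at mem_set // !det_mulmx det0 mulr0 mul0r.
Qed.

Lemma mem_dom_chart_at (R : realType) (n : nat) (X : complexManifold R n)
    (x : X) : dom (chart_at x) x.
Proof. by case: X x. Qed.

(** Semipositive forms are either positive definite or of zero determinant, so
    that a bound by a nonnegative function concerns the former only. *)
Lemma Qpos_det_rel_neq0 (R : realType) (n : nat) (X : complexManifold R n)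
    (rho : X -> chart_index X -> 'M[R[i]]_n) (x : X)
    (p : chart_index X -> 'M[R[i]]_n) :
  Qpos x p -> det_rel rho x p != 0 -> Qposdef x p.
Proof.
move=> [Qp p_ge0] det_neq0; split=> // i xi.
have [p_herm _] := Qp i xi.
apply: semipositive_invertible_gt0 => //; first exact: p_ge0.
apply: contraNneq det_neq0 => deti0; apply/eqP/prod_rel_eigenvalues_det0.
exact: Q_det_eq0 Qp xi (mem_dom_chart_at _ _ _ x) deti0.
Qed.

Theorem proposition2p8 (R : realType) (n : nat) (X : complexManifold R n)
    (rho omega chi : X -> chart_index X -> 'M[R[i]]_n)
    (F : X -> (chart_index X -> 'M[R[i]]_n) -> R)
    (A : X -> set (chart_index X -> 'M[R[i]]_n))
    (eta beta kappa : R) (u psi : X -> R) :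
  compact [set: X] -> connected [set: X] -> kahler_form rho ->
  smooth_form omega -> closed_form omega ->
  smooth_form chi -> closed_form chi ->
  0 < kappa -> smooth_fun u ->
  smooth_fun psi -> (forall x, 0 < psi x) ->
  admissible F A -> 0 < eta -> 0 < beta -> det_elliptic rho F A eta beta ->
  let omega_u := fun x => omega x + ddc kappa u x in
  (forall x, A x (omega_u x - chi x)) ->
  let d := fun x =>
    (eta^-1 * Num.max (psi x - F x (omega_u x - chi x)) 0) `^ (beta^-1) in
  (forall x p, Qpos x p -> A x (omega_u x - chi x + p) ->
     F x (omega_u x - chi x + p) <= psi x -> det_rel rho x p <= d x) /\
  (forall gamma : X -> R, continuous gamma ->
     (forall x, d x <= expR (gamma x)) ->
     D_subsolution rho F A psi omega_u chi gamma).
Proof.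
move=> _ _ _ _ _ _ _ _ _ _ _ _ eta_gt0 beta_gt0 ell omega_u A_base d.
have bound x p : Qpos x p -> A x (omega_u x - chi x + p) ->
    F x (omega_u x - chi x + p) <= psi x -> det_rel rho x p <= d x.
  move=> p_ge0 _ F_le; have d_ge0 : 0 <= d x by apply: powR_ge0.
  have [det_le0|det_gt0] := leP (det_rel rho x p) 0.
    exact: le_trans det_le0 d_ge0.
  have p_gt0 : Qposdef x p by apply: Qpos_det_rel_neq0 p_ge0 (lt0r_neq0 det_gt0).
  have det_le : det_rel rho x p `^ beta <=
      eta^-1 * Num.max (psi x - F x (omega_u x - chi x)) 0.
    rewrite ler_pdivlMl //; apply: le_trans (ell x _ _ (A_base x) p_gt0) _.
    by rewrite le_max lerD2r F_le.
  have -> : det_rel rho x p = (det_rel rho x p `^ beta) `^ beta^-1.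
    by rewrite -powRrM mulfV ?gt_eqF // powRr1 // ltW.
  apply: ge0_ler_powR det_le; rewrite ?nnegrE ?powR_ge0 //.
    by rewrite invr_ge0 ltW.
  by rewrite mulr_ge0 ?invr_ge0 ?(ltW eta_gt0) // le_max lexx orbT.
split=> // gamma gamma_cont d_le; split=> // x p p_ge0 Ap F_le.
exact: le_trans (bound x p p_ge0 Ap F_le) (d_le x).
Qed.
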